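(* Let $m$ be a positive integer. For all $\mathbf{n}\in\mathbb{N}^m$, all $\mathbf{z}\in\mathbb{C}^m$, and all $x,s\in\mathbb{C}$, $$ \sum_{\mathbf{k}=\mathbf{0}}^{\mathbf{n}}\binom{|\mathbf{k}|+s}{\mathbf{k}}\binom{x-|\mathbf{k}|}{\mathbf{n}-\mathbf{k}}\mathbf{z}^{\mathbf{k}} =\sum_{\mathbf{k}=\mathbf{0}}^{\mathbf{n}}\binom{|\mathbf{k}|+s}{\mathbf{k}}\binom{x+s+1}{\mathbf{n}-\mathbf{k}}(\mathbf{z}-\mathbf{1})^{\mathbf{k}}. $$
   Context: $\mathbb{N}$ denotes the nonnegative integers (including $0$), and $m$ is a fixed positive integer. For $\mathbf{a}=(a_1,\ldots,a_m)\in\mathbb{N}^m$ and $\mathbf{b}=(b_1,\ldots,b_m)\in\mathbb{C}^m$, set $|\mathbf{a}|=a_1+\cdots+a_m$, $\mathbf{a}!=a_1!\cdots a_m!$, and $\mathbf{b}^{\mathbf{a}}=b_1^{a_1}\cdots b_m^{a_m}$ (with $0^0=1$); addition and subtraction of vectors are componentwise. Write $\mathbf{0}=(0,\ldots,0)$ and $\mathbf{1}=(1,\ldots,1)$. The sum $\sum_{\mathbf{k}=\mathbf{0}}^{\mathbf{n}}$ runs over all $\mathbf{k}=(k_1,\ldots,k_m)\in\mathbb{N}^m$ with $0\le k_i\le n_i$ for every $i$. For any $x$ (a complex number or variable) and $\mathbf{n}=(n_1,\ldots,n_m)\in\mathbb{Z}^m$, the multinomial coefficient is defined by $$\binom{x}{\mathbf{n}}=\frac{x(x-1)\cdots(x-|\mathbf{n}|+1)}{\mathbf{n}!}\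 \text{ if } \mathbf{n}\in\mathbb{N}^m,\qquad \binom{x}{\mathbf{n}}=0\ \text{ otherwise}$$ (the numerator is the empty product $1$ if $\mathbf{n}=\mathbf{0}$). *)

(* Defs.v *)
From mathcomp Require Import all_boot all_order all_algebra.
Set Implicit Arguments.
Unset Strict Implicit.
Unset Printing Implicit Defensive.
Import GRing.Theory.
Local Open Scope ring_scope.

Definition vsum (m : nat) (a : {ffun 'I_m -> nat}) : nat := (\sum_i a i)%N.

Definition vfact (m : nat) (a : {ffun 'I_m -> nat}) : nat := (\prod_i (a i)`!)%N.

Definition vpow (F : fieldType) (m : nat) (b : {ffun 'I_m -> F})
    (a : {ffun 'I_m -> nat}) : F := \prod_i b i ^+ a i.

Definition vint (m : nat) (a : {ffun 'I_m -> nat}) : {ffun 'I_m -> int} :=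
  [ffun i => (a i)%:Z].

Definition vabs (m : nat) (n : {ffun 'I_m -> int}) : {ffun 'I_m -> nat} :=
  [ffun i => `|n i|%N].

Definition mbinom (F : fieldType) (m : nat) (x : F)
    (n : {ffun 'I_m -> int}) : F :=
  if [forall i, 0 <= n i] then
    (\prod_(j < vsum (vabs n)) (x - j%:R)) / (vfact (vabs n))%:R
  else 0.

(* The index set of a sum from 0 to n: vectors k with k_i in {0, ..., n_i}. *)
Definition box (m : nat) (n : {ffun 'I_m -> nat}) : finType :=
  {dffun forall i : 'I_m, 'I_(n i).+1}.

Definition boxval (m : nat) (n : {ffun 'I_m -> nat}) (k : box n) :
    {ffun 'I_m -> nat} := [ffun i => nat_of_ord (k i)].

(* Main.v *)
Require Import Defs.
From HB Require Import structures.
From mathcomp Require Import all_boot all_order all_algebra.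
From mathcomp Require Import ring.
From mathcomp Require Import reals complex.
Set Implicit Arguments.
Unset Strict Implicit.
Unset Printing Implicit Defensive.
Import GRing.Theory.
Local Open Scope ring_scope.

(** Both sides are values of one linear functional on one polynomial, written
    in two bases.

    Put [M = |n|] and let [(y)_j] be the falling factorial.  Multiplying the
    left side by [n!] turns the product of the two multinomial coefficients
    into the product of the ordinary binomials [C(n_i, k_i)] times the weight
    [c_r = (r + s)_r (x - r)_(M - r)], which depends on [k] only through
    [r = |k|].  So if [L] is the linear functional on polynomials sending
    ['X^r] to [c_r] for [r <= M], the left side times [n!] is [L P] with
    [P = \prod_i (1 + z_i X)^n_i] (lemma [prod_expand] with [u = 1]).

    Now regroup [1 + z_i X = (1 + X) + (z_i - 1) X]: expanding with
    [u = 1 + X], the same [P] is a combination of the polynomials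
    [X^k (1 + X)^(M - k)], with coefficients given by [C(n_i, k_i)] and powers
    of [z_i - 1].  The functional takes the value
    [(k + s)_k (x + s + 1)_(M - k)] on [X^k (1 + X)^(M - k)]
    (lemma [umbra_basis]), and this is exactly the weight on the right side. *)

(** * Distributivity over dependent boxes *)

(** The factors of the product have different index types, so the sums are first
    moved to the common type of tagged indices, where ordinary distributivity
    applies. *)
Lemma prod_sum_dffun (S : comPzSemiRingType) (I : finType) (T : I -> finType)
    (F : forall i, T i -> S) :
  \prod_i \sum_(j : T i) F i j
  = \sum_(f : {dffun forall i, T i}) \prod_i F i (f i).
Proof.
under eq_bigr => i _ do rewrite big_tag.
rewrite bigA_distr_big_dep.
transitivity (\sum_(t : fprod T) \prod_i [ffun j => F i j] (t i)).
  rewrite (big_fprod 1 _ (fun i => [ffun j => F i j])).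
  apply: eq_bigr => g _; apply: eq_bigr => i _.
  by rewrite /untag; case: eqP => // e; rewrite ffunE.
rewrite (reindex (@fprod_of_dffun I T)) /=; last first.
  exact: onW_bij (fprod_of_dffun_bij T).
by apply: eq_bigr => f _; apply: eq_bigr => i _; rewrite ffunE fprodE.
Qed.

Section Box.
Variables (m : nat) (n : {ffun 'I_m -> nat}).
Implicit Type k : box n.

Lemma boxval_le k i : (boxval k i <= n i)%N.
Proof. by rewrite ffunE -ltnS. Qed.

Lemma vsum_boxval_le k : (vsum (boxval k) <= vsum n)%N.
Proof. by apply: leq_sum => i _; apply: boxval_le. Qed.

Lemma vsum_sub_boxval k :
  (\sum_i (n i - boxval k i) = vsum n - vsum (boxval k))%N.
Proof. by rewrite sumnB // => i _; apply: boxval_le. Qed.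

Definition box_binom k : nat := \prod_i 'C(n i, boxval k i).

(** The link between the two normalisations: [1 / (k! (n - k)!)] is
    [box_binom k / n!]. *)
Lemma box_binom_fact k :
  (box_binom k * (vfact (boxval k) * \prod_i (n i - boxval k i)`!) = vfact n)%N.
Proof.
rewrite /box_binom /vfact -!big_split /=; apply: eq_bigr => i _.
by rewrite bin_fact // boxval_le.
Qed.

(** Leaving [u] arbitrary is what allows the same polynomial to be expanded both
    in powers of ['X] and in the basis ['X^k * (1 + 'X)^(M - k)]. *)
Lemma prod_expand (F : fieldType) (v : {ffun 'I_m -> F}) (u : {poly F}) :
  \prod_i (u + v i *: 'X) ^+ n i
  = \sum_(k : box n) ((box_binom k)%:R * vpow v (boxval k))
      *: ('X^(vsum (boxval k)) * u ^+ (vsum n - vsum (boxval k))).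
Proof.
under eq_bigr => i _ do rewrite exprDn.
rewrite prod_sum_dffun; apply: eq_bigr => k _.
have -> : \prod_i (u ^+ (n i - k i) * (v i *: 'X) ^+ k i *+ 'C(n i, k i))
  = \prod_i (('C(n i, boxval k i)%:R * v i ^+ boxval k i) *:
        ('X^(boxval k i) * u ^+ (n i - boxval k i))).
  apply: eq_bigr => i _; rewrite ffunE exprZn -scalerA scaler_nat -scaler_nat.
  by rewrite -scalerAr mulrC scaler_nat.
rewrite scaler_prod !big_split /= -natr_prod.
by rewrite !prodrXr vsum_sub_boxval.
Qed.

End Box.

(** * Multinomial coefficients as falling factorials *)

Definition fall (F : fieldType) (y : F) (j : nat) : F :=
  \prod_(i < j) (y - i%:R).

Lemma fall0 (F : fieldType) (y : F) : fall y 0 = 1.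
Proof. exact: big_ord0. Qed.

Lemma fallSl (F : fieldType) (y : F) j : fall y j.+1 = y * fall (y - 1) j.
Proof.
rewrite /fall big_ord_recl subr0; congr (_ * _); apply: eq_bigr => i _.
by rewrite lift0 -natr1 opprD addrAC addrA.
Qed.

Lemma fallSr (F : fieldType) (y : F) j : fall y j.+1 = fall y j * (y - j%:R).
Proof. by rewrite /fall big_ord_recr. Qed.

Lemma mbinom_nat (F : fieldType) m (y : F) (a : {ffun 'I_m -> nat}) :
  mbinom y (vint a) = fall y (vsum a) / (vfact a)%:R.
Proof.
rewrite /mbinom; have -> : vabs (vint a) = a by apply/ffunP=> i; rewrite !ffunE.
by case: ifP => // /forallP[] i; rewrite ffunE.
Qed.

(** After the factor [1 / n!] is taken out, the shifts [y] and [w] enter only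
    through falling factorials whose lengths depend on [k] through [|k|]. *)
Lemma mbinom_box (F : numFieldType) m (n : {ffun 'I_m -> nat}) (k : box n)
    (y w : F) :
  mbinom y (vint (boxval k)) * mbinom w (vint n - vint (boxval k))
  = (vfact n)%:R^-1 * (box_binom k)%:R
    * (fall y (vsum (boxval k)) * fall w (vsum n - vsum (boxval k))).
Proof.
have -> : vint n - vint (boxval k) = vint [ffun i => n i - boxval k i]%N.
  by apply/ffunP=> i; rewrite !ffunE subzn // -ltnS.
rewrite !mbinom_nat -(box_binom_fact k).
have -> : vsum [ffun i => n i - boxval k i]%N = (vsum n - vsum (boxval k))%N.
  by rewrite -vsum_sub_boxval; apply: eq_bigr => i _; rewrite ffunE.
have -> : vfact [ffun i => n i - boxval k i]%N = (\prod_i (n i - boxval k i)`!)%N.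
  by apply: eq_bigr => i _; rewrite ffunE.
have fact_neq0 (a : 'I_m -> nat) : (\prod_i (a i)`!)%:R != 0 :> F.
  by rewrite Num.Theory.pnatr_eq0 -lt0n prodn_gt0 // => i; apply: fact_gt0.
have kfN0 : (vfact (boxval k))%:R != 0 :> F by apply: fact_neq0.
have nfN0 := fact_neq0 (fun i => n i - boxval k i)%N.
have : (vfact n)%:R != 0 :> F by apply: fact_neq0.
rewrite -(box_binom_fact k) !natrM !mulf_eq0 !negb_or => /andP[bN0 _].
by field; rewrite kfN0 nfN0 bN0.
Qed.

(** * The umbral functional *)

Section Umbra.
Variables (F : fieldType) (M : nat) (x s : F).

Definition weight (r : nat) : F := fall (r%:R + s) r * fall (x - r%:R) (M - r).

(** The linear functional with ['X^r |-> weight r]; the sum stops at [M] because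
    only polynomials of degree at most [M] matter. *)
Definition umbra (p : {poly F}) : F := \sum_(r < M.+1) p`_r * weight r.

Fact umbra_is_linear : linear_for *%R umbra.
Proof.
move=> a p q; rewrite /umbra mulr_sumr -big_split /=; apply: eq_bigr => r _.
by rewrite coefD coefZ mulrDl mulrA.
Qed.
HB.instance Definition _ :=
  GRing.isLinear.Build F {poly F} F *%R umbra umbra_is_linear.

Lemma umbraXn r : (r <= M)%N -> umbra 'X^r = weight r.
Proof.
move=> le_rM; rewrite /umbra (bigD1 (Ordinal (le_rM : (r < M.+1)%N))) //=.
rewrite coefXn eqxx mul1r big1 ?addr0 // => i /eqP neq_ir.
by rewrite coefXn; case: eqP => [e|]; rewrite ?mul0r //; case: neq_ir; apply: val_inj.
Qed.

(** Induction on [j] by [(1 + 'X)^(j+1) = (1 + 'X)^j + 'X (1 + 'X)^j].  Exponents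
    with [k + j < M] have to be allowed for this, whence the last factor.  With
    the common factors removed, the induction step is
    [(x - k - j) + (s + 1 + k) = x + s + 1 - j]. *)
Lemma umbra_Xn_1DXn j k : (k + j <= M)%N ->
  umbra ('X^k * (1 + 'X) ^+ j)
  = fall (k%:R + s) k * fall (x + s + 1) j
    * fall (x - (k + j)%:R) (M - (k + j)).
Proof.
elim: j k => [|j IHj] k le_kj.
  rewrite addn0 in le_kj *.
  by rewrite expr0 mulr1 umbraXn // /weight fall0 mulr1.
have -> : 'X^k * (1 + 'X) ^+ j.+1
    = 'X^k * (1 + 'X) ^+ j + 'X^(k.+1) * (1 + 'X) ^+ j :> {poly F}.
  by rewrite !exprS; ring.
rewrite linearD /= !IHj ?addSnnS //; last by rewrite ltnW // -addnS.
have -> : (M - (k + j) = (M - (k + j.+1)).+1)%N by rewrite -subSn // addnS subSS.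
rewrite [fall _ j.+1]fallSr !fallSl.
have -> : k.+1%:R + s - 1 = k%:R + s by rewrite -natr1; ring.
have -> : x - (k + j)%:R - 1 = x - (k + j.+1)%:R.
  by rewrite addnS -natr1; ring.
by rewrite natrD -[k.+1%:R]natr1; ring.
Qed.

Lemma umbra_basis k : (k <= M)%N ->
  umbra ('X^k * (1 + 'X) ^+ (M - k))
  = fall (k%:R + s) k * fall (x + s + 1) (M - k).
Proof.
by move=> le_kM; rewrite umbra_Xn_1DXn subnKC // subnn fall0 mulr1.
Qed.

End Umbra.

(** * The identity *)

(** Characteristic zero is what the proof uses of the complex numbers: it makes
    the factorials in the denominators invertible. *)
Lemma mbinom_sum_shift (F : numFieldType) (m : nat) (n : {ffun 'I_m -> nat})
    (z : {ffun 'I_m -> F}) (x s : F) :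
  \sum_(k : box n)
     mbinom ((vsum (boxval k))%:R + s) (vint (boxval k))
     * mbinom (x - (vsum (boxval k))%:R) (vint n - vint (boxval k))
     * vpow z (boxval k)
  = \sum_(k : box n)
     mbinom ((vsum (boxval k))%:R + s) (vint (boxval k))
     * mbinom (x + s + 1) (vint n - vint (boxval k))
     * vpow (z - [ffun => 1]) (boxval k).
Proof.
pose P : {poly F} := \prod_i (1 + z i *: 'X) ^+ n i.
transitivity ((vfact n)%:R^-1 * umbra (vsum n) x s P).
  rewrite /P prod_expand linear_sum mulr_sumr; apply: eq_bigr => k _.
  rewrite linearZ /= expr1n mulr1 umbraXn ?vsum_boxval_le // mbinom_box.
  by rewrite /weight; ring.
have -> : P = \prod_i ((1 + 'X) + (z - [ffun => 1]) i *: 'X) ^+ n i.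
  apply: eq_bigr => i _; rewrite !ffunE scalerBl scale1r.
  by rewrite -addrA subrKC.
rewrite prod_expand linear_sum mulr_sumr; apply: eq_bigr => k _.
by rewrite linearZ /= umbra_basis ?vsum_boxval_le // mbinom_box; ring.
Qed.

Theorem theorem4p2 (R : realType) (m : nat) (m_gt0 : (0 < m)%N)
    (n : {ffun 'I_m -> nat}) (z : {ffun 'I_m -> R[i]}) (x s : R[i]) :
  \sum_(k : box n)
     mbinom ((vsum (boxval k))%:R + s) (vint (boxval k))
     * mbinom (x - (vsum (boxval k))%:R) (vint n - vint (boxval k))
     * vpow z (boxval k)
  = \sum_(k : box n)
     mbinom ((vsum (boxval k))%:R + s) (vint (boxval k))
     * mbinom (x + s + 1) (vint n - vint (boxval k))
     * vpow (z - [ffun => 1]) (boxval k).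
Proof. exact: mbinom_sum_shift. Qed.
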